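(* Let $n\ge3$ and $k\in\mathbb N$. For $\mathbf j=(j_1,\dots,j_{n-1})\in\mathbb N^{n-1}$ define $$\psi_{\mathbf j}(x_1,\dots,x_n)=\mathbf{CK}_{x_n}^{\mu_n}\Big[(X_{[n-1]}^q)^{j_{n-1}}\mathbf{CK}_{x_{n-1}}^{\mu_{n-1}}\Big[\cdots\Big[(X_{[2]}^q)^{j_2}\mathbf{CK}_{x_2}^{\mu_2}(x_1^{j_1})\Big]\cdots\Big]\Big].$$ Then the set $\left\{\psi_{\mathbf j}:\mathbf j\in\mathbb N^{n-1},\ \sum_{i=1}^{n-1}j_i=k\right\}$ forms a basis for $\mathcal M_k^q(\mathbb R^n)$.
   Context: Let $q$ be a nonzero complex number with $|q|\neq1$ (fix a logarithm of $q$ to define $q^a$ for real $a$); $[a]_q=\frac{q^a-q^{-a}}{q-q^{-1}}$, $[j]=\{1,\dots,j\}$. $\mathcal P(\mathbb R^j)$ is the space of complex-valued polynomials in $x_1,\dots,x_j$ and $\mathcal P_k(\mathbb R^j)$ its homogeneous part of degree $k$. Fix $\mu_1,\dots,\mu_n>0$, $\gamma_i=\mu_i+\frac12$, $\gamma_{[j]}=\sum_{i\le j}\gamma_i$. Let $r_i$ be the substitution $x_i\mapsto-x_i$ and $T_{q,i}^{s}$ the substitution $x_i\mapsto q^sx_i$, and $$D_i^q=\frac{q^{\mu_i}}{q-q^{-1}}\,\frac{T_{q,i}-r_i}{x_i}-\frac{q^{-\mu_i}}{q-q^{-1}}\,\frac{T_{q,i}^{-1}-r_i}{x_i}.$$ For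 $1\le j\le n$, $$D_{[j]}^q=\sum_{i=1}^jD_i^qR_{[j],i}^q,\quad X_{[j]}^q=\sum_{i=1}^jx_iR_{[j],i}^q,\quad R^q_{[j],i}=\Big(\prod_{l<i}q^{-\gamma_l/2}T_{q,l}^{-1/2}\Big)\Big(\prod_{i<l\le j}q^{\gamma_l/2}T_{q,l}^{1/2}r_l\Big)\Big(\prod_{j<l\le n}r_l\Big),$$ and $\mathcal M_k^q(\mathbb R^j)=\ker(D_{[j]}^q)\cap\mathcal P_k(\mathbb R^j)$. For $2\le j\le n$ the map $\mathbf{CK}_{x_j}^{\mu_j}:\mathcal P_k(\mathbb R^{j-1})\to\mathcal M_k^q(\mathbb R^j)$ is, for each $k$, $$\mathbf{CK}_{x_j}^{\mu_j}=\sum_{\alpha=0}^k\frac{(-1)^{\alpha(\alpha+1)/2}q^{\frac{\alpha}{2}(\gamma_{[j]}+k-1)}}{[\mu_j,\alpha;q][\mu_j,\alpha-1;q]\cdots[\mu_j,1;q]}\,x_j^\alpha\left(D_{[j-1]}^q\right)^\alpha,\qquad[\mu_j,m;q]=[\mu_j+m]_q-(-1)^m[\mu_j]_q$$ (empty products equal $1$). *)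

(* Defs.v *)
From mathcomp Require Import all_boot all_order all_algebra.
From mathcomp Require Import complex mpoly.
From mathcomp Require Import reals sequences exp trigo.

Set Implicit Arguments.
Unset Strict Implicit.
Unset Printing Implicit Defensive.

Import Order.TTheory GRing.Theory Num.Theory.

Local Open Scope ring_scope.
Local Open Scope complex_scope.

(* The subfamily (v i), P i, is a basis of the linear subspace M of V. Linear
   combinations are finite: s lists the (distinct) indices they involve. *)
Definition is_basis (K : fieldType) (V : lmodType K) (I : eqType)
    (P : pred I) (v : I -> V) (M : V -> Prop) : Prop :=
  [/\ forall i, P i -> M (v i),
      forall (s : seq I) (c : I -> K), uniq s -> all P s ->
        \sum_(i <- s) c i *: v i = 0 -> forall i, i \in s -> c i = 0
    & forall x, M x -> exists (s : seq I) (c : I -> K),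
        [/\ uniq s, all P s & x = \sum_(i <- s) c i *: v i]].

Definition cexp (R : realType) (z : R[i]) : R[i] :=
  let: a +i* b := z in (expR a)%:C * (cos b +i* sin b).

Section Substitution.
Variables (F : fieldType) (n : nat).
Implicit Types (i : 'I_n) (c : F) (p : {mpoly F[n]}) (m : 'X_{1..n}).

(* The substitution x_i |-> c x_i. *)
Definition msubst i c p : {mpoly F[n]} :=
  p \mPo [tuple (if l == i then c *: 'X_l else 'X_l) | l < n].

(* Quotient by x_i. The monomials free of x_i are dropped, so this is the
   exact quotient only for polynomials divisible by x_i; see mdivX_substK. *)
Definition mdivX i p : {mpoly F[n]} :=
  \sum_(m <- msupp p | (0 < m i)%N) p@_m *: 'X_[m - U_(i)].

Lemma msubstX i c m : msubst i c 'X_[m] = c ^+ m i *: 'X_[m].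
Proof.
rewrite /msubst comp_mpolyX (bigD1 i) //= tnth_mktuple eqxx exprZn -scalerAl.
congr (_ *: _).
have -> : 'X_[m] = \prod_(l < n) 'X_l ^+ m l :> {mpoly F[n]}.
  exact: mpolyXE_id.
rewrite [RHS](bigD1 i) //=; congr (_ * _).
by apply: eq_bigr => l /negPf ne_li; rewrite tnth_mktuple ne_li.
Qed.

Lemma mcoeff_msubst i c p m : (msubst i c p)@_m = c ^+ m i * p@_m.
Proof.
have -> : msubst i c p = \sum_(m' <- msupp p) p@_m' *: msubst i c 'X_[m'].
  by rewrite /msubst {1}comp_mpolyEX.
rewrite [in RHS](mpolyE p) !linear_sum mulr_sumr /=; apply: eq_bigr => m' _.
rewrite msubstX !mcoeffZ mcoeffX mulrCA.
by case: eqP => [->|_]; rewrite ?mulr0.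
Qed.

Lemma mdivXK i p :
  (forall m, m i = 0%N -> p@_m = 0) -> 'X_i * mdivX i p = p.
Proof.
move=> p0; rewrite /mdivX mulr_sumr big_mkcond {3}[p]mpolyE /=.
apply: eq_bigr => m _; case: ltnP => [mi_gt0|]; last first.
  by rewrite leqn0 => /eqP /p0 ->; rewrite scale0r.
rewrite -scalerAr -mpolyXD; congr (_ *: 'X_[_]).
by rewrite addmC submK // lep1mP -lt0n.
Qed.

Lemma mdivX_substK i c d p :
  'X_i * mdivX i (msubst i c p - msubst i d p) = msubst i c p - msubst i d p.
Proof.
by apply: mdivXK => m mi0; rewrite mcoeffB !mcoeff_msubst mi0 !expr0 subrr.
Qed.

End Substitution.

(* Indices are 0-based: 'X_l and mu l stand for x_{l+1} and mu_{l+1}, and the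
   set [j] = {1, ..., j} becomes the l with l < j.
   Polynomials in x_1, ..., x_j are seen as elements of {mpoly R[i][n]}.
   The parameter lq is the chosen logarithm of q. *)
Section QDunkl.
Variables (R : realType) (lq : R[i]) (n : nat) (mu : 'I_n -> R).
Implicit Types (i l : 'I_n) (j k : nat) (p : {mpoly R[i][n]}).

Definition qpow (a : R) : R[i] := cexp (a%:C * lq).

Definition qnum (a : R) : R[i] :=
  (qpow a - qpow (- a)) / (qpow 1 - qpow (-1)).

Definition qbr (a : R) (m : nat) : R[i] :=
  qnum (a + m%:R) - (-1) ^+ m * qnum a.

Definition gam l : R := mu l + 2^-1.

Definition gamsum j : R := \sum_(l < n | (l < j)%N) gam l.

Definition qT l (s : R) p : {mpoly R[i][n]} := msubst l (qpow s) p.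

Definition refl l p : {mpoly R[i][n]} := msubst l (-1) p.

Definition Dq i p : {mpoly R[i][n]} :=
  (qpow (mu i) / (qpow 1 - qpow (-1))) *: mdivX i (qT i 1 p - refl i p)
  - (qpow (- mu i) / (qpow 1 - qpow (-1))) *: mdivX i (qT i (-1) p - refl i p).

Definition Rq j i : {mpoly R[i][n]} -> {mpoly R[i][n]} :=
  (\big[(fun f g => f \o g)/id]_(l < n | (l < i)%N)
      (fun p => qpow (- (gam l / 2)) *: qT l (- 2^-1) p))
  \o (\big[(fun f g => f \o g)/id]_(l < n | (i < l < j)%N)
      (fun p => qpow (gam l / 2) *: qT l 2^-1 (refl l p)))
  \o (\big[(fun f g => f \o g)/id]_(l < n | (j <= l)%N) refl l).

Definition Dbr j p : {mpoly R[i][n]} :=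
  \sum_(i < n | (i < j)%N) Dq i (Rq j i p).

Definition Xbr j p : {mpoly R[i][n]} :=
  \sum_(i < n | (i < j)%N) 'X_i * Rq j i p.

Definition Phom j k p : Prop :=
  p \is k.-homog /\
  forall m : 'X_{1..n}, m \in msupp p -> forall l, (j <= l)%N -> m l = 0%N.

Definition Mhom j k p : Prop := Phom j k p /\ Dbr j p = 0.

(* The map CK at the variable 'X_l on P_k(R^l), so that D_[j-1] is Dbr l and
   gamma_[j] is gamsum l.+1. *)
Definition CK l k p : {mpoly R[i][n]} :=
  \sum_(a < k.+1)
    ((-1) ^+ (a * a.+1)./2 * qpow (a%:R / 2 * (gamsum l.+1 + k%:R - 1))
       / \prod_(1 <= m < a.+1) qbr (mu l) m)
    *: ('X_l ^+ a * iter a (Dbr l) p).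

(* For js = (j_1, j_2, ...), chi js 0 is x_1^{j_1} and, for m > 0, chi js m is
   X_[m+1]^{j_{m+1}} CK_{x_{m+1}} [ ... X_[2]^{j_2} CK_{x_2} (x_1^{j_1}) ... ].
   It is homogeneous of degree j_1 + ... + j_{m+1}, which is the degree at which
   the next CK is taken. *)
Fixpoint chi (js : seq nat) (m : nat) : (m < n)%N -> {mpoly R[i][n]} :=
  match m with
  | 0 => fun lt_mn => 'X_(Ordinal lt_mn) ^+ nth 0%N js 0
  | m'.+1 => fun lt_mn =>
      iter (nth 0%N js m'.+1) (Xbr m'.+2)
        (CK (Ordinal lt_mn) (\sum_(l < m'.+1) nth 0%N js l)%N
           (chi js (ltnW lt_mn)))
  end.

Lemma ltn_pred1n : (2 < n -> n.-1 < n)%N.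
Proof. by case: (n). Qed.

Lemma ltn_pred2n : (2 < n -> n.-2 < n)%N.
Proof. by case: (n) => [|[|n']] // _; apply: ltnW. Qed.

Definition psi (hn : (2 < n)%N) (js : n.-1.-tuple nat) : {mpoly R[i][n]} :=
  CK (Ordinal (ltn_pred1n hn)) (\sum_(l < n.-1) tnth js l)%N
    (chi js (ltn_pred2n hn)).

End QDunkl.

(* Main.v *)
Require Import Defs.
From mathcomp Require Import all_boot all_order all_algebra.
From mathcomp Require Import complex mpoly.
From mathcomp Require Import reals.
From HB Require Import structures.
From mathcomp Require Import ring.
From mathcomp Require Import boolp sequences exp trigo.

Set Implicit Arguments.
Unset Strict Implicit.
Unset Printing Implicit Defensive.

Import Order.TTheory GRing.Theory Num.Theory.

Local Open Scope ring_scope.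
Local Open Scope complex_scope.

(* Each one-variable pair (D_i, x_i) satisfies D_i x_i + x_i D_i = h(K_i) for the
   diagonal operator K_i, and the twists R_[j],i are chosen so that the mixed
   terms of D_[j] X_[j] + X_[j] D_[j] cancel and the diagonal ones telescope.
   Hence D_[j] X_[j] + X_[j] D_[j] is a scalar on each P_k(R^j), and
   D_[j] X_[j]^a is a scalar times X_[j]^(a-1) on M_d(R^j); that scalar is the
   number [mu, a; q] at mu = gamma_[j] + d - 1/2 > 0, which is nonzero because
   |q| <> 1. This yields the Fischer decomposition of P_k(R^j) as the direct sum
   of the X_[j]^a M_(k-a)(R^j).  On the other hand the equation D_[j] p = 0 is a
   recursion in the degree of x_j, solved by CK, so CK is a bijection
   from P_k(R^(j-1)) onto M_k(R^j), with inverse the restriction to x_j = 0.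
   Alternating the two steps from the basis x_1^k of P_k(R^1) gives the bases. *)

(** * The complex exponential and its modulus *)

Section CExp.
Variable R : realType.
Implicit Types z w : R[i].

Lemma cexpD z w : cexp (z + w) = cexp z * cexp w.
Proof.
case: z w => [a b] [c d]; rewrite /cexp /= expRD cosD sinD.
by apply/eqP; rewrite eq_complex /=; apply/andP; split; apply/eqP; ring.
Qed.

Lemma norm_cexp z : `|cexp z| = (expR (complex.Re z))%:C.
Proof.
case: z => a b; rewrite /cexp normrM.
have -> : `|cos b +i* sin b| = 1 :> R[i].
  by rewrite normc_def /= cos2Dsin2 sqrtr1.
by rewrite mulr1 normc_def /= expr0n addr0 sqrtr_sqr ger0_norm ?expR_ge0.
Qed.

End CExp.

(** * Powers of q and q-numbers *)

Section QNumbers.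
Variables (R : realType) (lq : R[i]).
Hypothesis lq_neq0 : complex.Re lq != 0.
Implicit Types a b : R.

Local Notation qpow := (qpow lq).
Local Notation qnum := (qnum lq).
Local Notation qbr := (qbr lq).

Lemma qpowD a b : qpow (a + b) = qpow a * qpow b.
Proof. by rewrite /Defs.qpow -cexpD rmorphD mulrDl. Qed.

Lemma norm_qpow a : `|qpow a| = (expR (a * complex.Re lq))%:C.
Proof.
by rewrite /Defs.qpow norm_cexp; case: lq => x y /=; rewrite mul0r subr0.
Qed.

Lemma qpow_neq0 a : qpow a != 0.
Proof.
rewrite -normr_eq0 norm_qpow; apply/eqP => -[] /eqP.
by rewrite expR_eq0.
Qed.

Lemma qpow0 : qpow 0 = 1.
Proof.
by apply: (mulfI (qpow_neq0 0)); rewrite -qpowD addr0 mulr1.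
Qed.

Lemma qpowN a : qpow (- a) = (qpow a)^-1.
Proof.
by apply: (mulfI (qpow_neq0 a)); rewrite -qpowD subrr qpow0 divff ?qpow_neq0.
Qed.

Lemma qpowMn a m : qpow (a * m%:R) = qpow a ^+ m.
Proof.
elim: m => [|m IH]; first by rewrite mulr0 qpow0 expr0.
by rewrite -natr1 mulrDr mulr1 qpowD IH exprSr.
Qed.

Lemma qpow_sum (T : finType) (Q : pred T) (f : T -> R) :
  \prod_(t | Q t) qpow (f t) = qpow (\sum_(t | Q t) f t).
Proof. exact/esym/(big_morph _ qpowD qpow0). Qed.

(** The modulus is exp(a Re [lq]). This is where |q| <> 1 enters, in the form Re [lq] <> 0. *)
Lemma norm_qpow_neq1 a : a != 0 -> `|qpow a| != 1.
Proof.
move=> a0; rewrite norm_qpow; apply/eqP => -[].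
rewrite -[X in _ = X]expR0 => /expR_inj/eqP.
by rewrite mulf_eq0 (negPf a0) (negPf lq_neq0).
Qed.

Lemma qpow1BV_neq0 : qpow 1 - qpow (-1) != 0.
Proof.
rewrite subr_eq0; apply/eqP => e.
have/eqP[]: `|qpow (1 + 1)| != 1.
  by apply: norm_qpow_neq1; rewrite (_ : 1 + 1 = 2%:R) ?pnatr_eq0 // -natrD.
by rewrite qpowD {2}e -qpowD subrr qpow0 normr1.
Qed.

(** With s = (-1)^m the numerator factors as (q^(a+m) - s q^a)(1 + s q^(-(2a+m))). A zero of either
    factor would give modulus 1 to q^m or to q^(-(2a+m)), whose exponents are nonzero. *)
Lemma qbr_neq0 a m : 0 < a -> (0 < m)%N -> qbr a m != 0.
Proof.
move=> a0 m0; have m0' : 0 < m%:R :> R by rewrite ltr0n.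
set s : R[i] := (-1) ^+ m.
have s2 : s * s = 1 by rewrite -expr2 sqrr_sign.
have -> : qbr a m = (qpow (a + m%:R) - s * qpow a)
    * (1 + s * qpow (- (a + a + m%:R))) / (qpow 1 - qpow (-1)).
  rewrite /Defs.qbr /Defs.qnum -/s mulrA -mulrBl; congr (_ / _).
  rewrite (_ : - (a + a + m%:R) = - a + - (a + m%:R)); last by ring.
  rewrite (qpowD (- a)) !(qpowN (_ + _)) !(qpowN a).
  have := qpow_neq0 a; have := qpow_neq0 (a + m%:R).
  move: (qpow a) (qpow (a + m%:R)) => x y y0 x0.
  have -> : (y - s * x) * (1 + s * (x^-1 * y^-1)) =
    y + s * x^-1 * (y / y) - s * x - (s * s) * (x / x) * y^-1 by ring.
  by rewrite s2 !divff //; ring.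
rewrite !mulf_neq0 ?invr_eq0 ?qpow1BV_neq0 //.
  rewrite qpowD mulrC -mulrBl mulf_neq0 ?qpow_neq0 // subr_eq0.
  apply/eqP => e; have/eqP[] := norm_qpow_neq1 (lt0r_neq0 m0').
  by rewrite e normrX normrN1 expr1n.
rewrite addrC addr_eq0; apply/eqP => e.
have/eqP[] : `|qpow (- (a + a + m%:R))| != 1.
  by apply: norm_qpow_neq1; rewrite oppr_eq0 gt_eqF // !addr_gt0.
have : `|s * qpow (- (a + a + m%:R))| = 1 by rewrite e normrN1.
by rewrite normrM normrX normrN1 expr1n mul1r.
Qed.

(* The value of D X + X D in degree d is [hnum (gamma + d)]. *)
Definition hnum (t : R) : R[i] :=
  (qpow 2^-1 + qpow (- 2^-1)) / (qpow 1 - qpow (-1))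
  * (qpow t - qpow (- t)).

Lemma qbr0 a : qbr a 0 = 0.
Proof. by rewrite /Defs.qbr addr0 mul1r subrr. Qed.

(** The signed terms cancel, and q^(1/2) + q^(-1/2) factors out around the midpoint a + m + 1/2.
    With a = mu_i this evaluates D_i x_i + x_i D_i; with a = gamma_[j] + d - 1/2 it is the recursion
    of the Fischer scalars. *)
Lemma qbrSD a m : qbr a m.+1 + qbr a m = hnum (a + 2^-1 + m%:R).
Proof.
rewrite /Defs.qbr /Defs.qnum /hnum exprS -natr1.
set e := (-1) ^+ m.
set t := a + 2^-1 + m%:R.
rewrite (_ : a + (m%:R + 1) = t + 2^-1); last by rewrite /t; field.
rewrite (_ : a + m%:R = t - 2^-1); last by rewrite /t; field.
rewrite !opprD opprK !qpowD.
by ring.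
Qed.

End QNumbers.

(** * Coefficients of one-variable operators and of diagonal composites *)

Section Coefficients.
Variables (F : fieldType) (n : nat).
Implicit Types (i l : 'I_n) (m : 'X_{1..n}) (p : {mpoly F[n]}).

Lemma mcoeff_mdivX i p m : (mdivX i p)@_m = p@_(m + U_(i)).
Proof.
rewrite /mdivX raddf_sum /= {3}[p]mpolyE raddf_sum /= big_mkcond /=.
apply: eq_bigr => m' _; rewrite mcoeffZ mcoeffX.
case: ltnP => [m'i_gt0|m'i0]; rewrite mcoeffZ mcoeffX.
  have le1 : (U_(i) <= m')%MM by rewrite lep1mP -lt0n.
  congr (_ * (nat_of_bool _)%:R); apply: (sameP eqP); apply: (iffP eqP) => [->|<-].
    by rewrite addmK.
  by rewrite submK.
rewrite leqn0 in m'i0; case: eqP => [e|_]; last by rewrite mulr0.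
by move: m'i0; rewrite e mnmDE mnm1E eqxx addn1.
Qed.

(** Serves to read off the eigenvalues of R_[j],i, a composite of operators that are diagonal on
    monomials. *)
Lemma mcoeff_comp (T : finType) (Q : pred T)
    (f : T -> {mpoly F[n]} -> {mpoly F[n]}) (c : T -> 'X_{1..n} -> F) :
  (forall t p m, (f t p)@_m = c t m * p@_m) ->
  forall p m,
    (((\big[(fun f g => f \o g)/id]_(t | Q t) f t) : _ -> {mpoly F[n]}) p)@_m
    = (\prod_(t | Q t) c t m) * p@_m.
Proof.
move=> fE p m; rewrite -(big_filter _ Q) -[X in X * _](big_filter _ Q).
elim: [seq t <- _ | _] => [|t s IH]; first by rewrite !big_nil mul1r.
by rewrite !big_cons /= fE IH mulrA.
Qed.

Lemma mcoeff_mdivX_subst i (c d : F) p m :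
  (mdivX i (msubst i c p - msubst i d p))@_m
  = (c ^+ (m i).+1 - d ^+ (m i).+1) * p@_(m + U_(i)).
Proof.
rewrite mcoeff_mdivX mcoeffB 2!mcoeff_msubst mnmDE mnm1E eqxx addn1.
by rewrite mulrBl.
Qed.

(** The shape of D_i with abstract constants: [a], [b] stand for the prefactors and [c], [c'], [d]
    for the scalings q, q^-1, -1. *)
Lemma mcoeff_Dunkl i (a b c c' d : F) p m :
  (a *: mdivX i (msubst i c p - msubst i d p)
   - b *: mdivX i (msubst i c' p - msubst i d p))@_m
  = a * ((c ^+ (m i).+1 - d ^+ (m i).+1) * p@_(m + U_(i)))
    - b * ((c' ^+ (m i).+1 - d ^+ (m i).+1) * p@_(m + U_(i))).
Proof.
rewrite mcoeffB; congr (_ - _); rewrite mcoeffZ; congr (_ * _).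
  exact: mcoeff_mdivX_subst.
exact: mcoeff_mdivX_subst.
Qed.

Lemma mcoeffXM0 i p m : m i = 0%N -> ('X_i * p)@_m = 0.
Proof.
move=> mi0; rewrite [p]mpolyE mulr_sumr raddf_sum big1 //= => m' _.
rewrite -scalerAr -mpolyXD mcoeffZ mcoeffX; case: eqP => [e|_].
  by move: mi0; rewrite -e mnmDE mnm1E eqxx.
by rewrite mulr0.
Qed.

End Coefficients.

(** * Weighted shifts on monomials *)

Section WeightedShifts.
Variables (F : fieldType) (n : nat) (Q : pred 'I_n).
Variables (c : 'I_n -> nat -> F) (r : 'I_n -> 'X_{1..n} -> F).
Variables D X : {mpoly F[n]} -> {mpoly F[n]}.
Implicit Types (i l : 'I_n) (m : 'X_{1..n}) (p : {mpoly F[n]}).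

Hypothesis c0 : forall i, c i 0 = 0.
Hypothesis DE : forall p m, (D p)@_m
  = \sum_(i < n | Q i) c i (m i).+1 * r i (m + U_(i)) * p@_(m + U_(i)).
Variable Y : 'I_n -> {mpoly F[n]} -> {mpoly F[n]}.
Hypothesis mcoeffY : forall i p m, Q i -> (Y i p)@_m = r i m * p@_m.
Hypothesis XE : forall p, X p = \sum_(i < n | Q i) 'X_i * Y i p.

Lemma lowering_is_linear : linear D.
Proof.
move=> a u v; apply/mpolyP => m.
rewrite mcoeffD mcoeffZ !DE mulr_sumr -big_split.
apply: eq_bigr => i _ /=.
by rewrite mcoeffD mcoeffZ mulrDr mulrCA.
Qed.

Lemma raising_is_linear : linear X.
Proof.
move=> a u v; rewrite !XE scaler_sumr -big_split; apply: eq_bigr => i Qi /=.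
rewrite scalerAr -mulrDr; congr (_ * _); apply/mpolyP => m.
by rewrite mcoeffD mcoeffZ !mcoeffY // mcoeffD mcoeffZ mulrDr mulrCA.
Qed.

Lemma raising_mpolyX m : X 'X_[m] = \sum_(i < n | Q i) r i m *: 'X_[m + U_(i)].
Proof.
rewrite XE; apply: eq_bigr => i Qi; rewrite addmC mpolyXD scalerAr.
congr (_ * _); apply/mpolyP => m'; rewrite mcoeffY // mcoeffZ mcoeffX.
by case: eqP => [->|]; rewrite ?mulr0.
Qed.

Lemma lowering_mpolyX m :
  D 'X_[m] = \sum_(i < n | Q i) (c i (m i) * r i m) *: 'X_[m - U_(i)].
Proof.
apply/mpolyP => m'; rewrite DE raddf_sum; apply: eq_bigr => i Qi /=.
rewrite mcoeffZ !mcoeffX; case: eqP => [->|ne].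
  by rewrite mnmDE mnm1E eqxx addn1 addmK eqxx.
rewrite mulr0; case: eqP => [e|]; last by rewrite mulr0.
(* If [m i] = 0, the truncated difference [m - U_(i)] is [m] itself, and the spurious term is
   removed by [c i 0 = 0]. *)
case: (posnP (m i)) => [->|mi0]; first by rewrite c0 !mul0r.
by case: ne; rewrite -e submK // lep1mP -lt0n.
Qed.

End WeightedShifts.

(** * The anticommutator of a lowering and a raising weighted shift *)

Section Anticommutator.
Variables (F : fieldType) (n : nat) (Q : pred 'I_n).
Variables (c : 'I_n -> nat -> F) (r : 'I_n -> 'X_{1..n} -> F) (s : 'I_n -> 'I_n -> F).
Variables D X : {linear {mpoly F[n]} -> {mpoly F[n]}}.
Implicit Types (i l : 'I_n) (m : 'X_{1..n}) (p : {mpoly F[n]}).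
Hypothesis c0 : forall i, c i 0 = 0.
Hypothesis DX : forall m,
  D 'X_[m] = \sum_(i < n | Q i) (c i (m i) * r i m) *: 'X_[m - U_(i)].
Hypothesis XX : forall m, X 'X_[m] = \sum_(i < n | Q i) r i m *: 'X_[m + U_(i)].
Hypothesis rDU : forall l m i, r l (m + U_(i)) = s l i * r l m.
Hypothesis s_diag : forall i, Q i -> s i i = 1.
Hypothesis s_anti : forall l i, Q l -> Q i -> l != i -> s i l * s l i = -1.

(** For l <> i, raising at i and lowering at l lead to the same monomial in either order. The two
    coefficients differ by the factor [s i l * s l i] = -1, so only the diagonal terms remain. *)
Lemma anticommutator_mpolyX m :
  D (X 'X_[m]) + X (D 'X_[m])
  = (\sum_(i < n | Q i) r i m * r i m * (c i (m i).+1 + c i (m i))) *: 'X_[m].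
Proof.
rewrite XX DX !linear_sum /=.
under eq_bigr do rewrite linearZ /= DX scaler_sumr.
under [X in _ + X]eq_bigr do rewrite linearZ /= XX scaler_sumr.
rewrite [X in _ + X]exchange_big -big_split /= scaler_suml.
apply: eq_bigr => i Qi; rewrite -big_split (bigD1 i) //= big1 ?addr0.
  rewrite mnmDE mnm1E eqxx addn1 addmK rDU s_diag // mul1r.
  case: (posnP (m i)) => [mi0|mi].
    by rewrite mi0 c0 mul0r scale0r addr0 scalerA addr0; congr (_ *: _); ring.
  have le1 : (U_(i) <= m)%MM by rewrite lep1mP -lt0n.
  have -> : r i (m - U_(i)) = r i m.
    by rewrite -{2}(submK le1) rDU s_diag // mul1r.
  by rewrite submK // !scalerA -scalerDl; congr (_ *: _); ring.
move=> l /andP[Ql ne_li].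
case: (posnP (m l)) => [ml0|ml].
  rewrite mnmDE mnm1E eq_sym (negPf ne_li) ml0 c0 !mul0r !scale0r.
  by rewrite scaler0 addr0.
have le1 : (U_(l) <= m)%MM by rewrite lep1mP -lt0n.
have : (m - U_(l) + U_(l))%MM = m by rewrite submK.
(* With [m] written as [m' + U_(l)], the rule [rDU] expresses all the weights through those at
   [m']. *)
move: (m - U_(l))%MM => m' <-.
rewrite mnmDE [U_(i)%MM l]mnm1E eq_sym (negPf ne_li) addn0.
rewrite -addmA [(U_(l) + _)%MM]addmC addmA !addmK !rDU.
rewrite !scalerA -scalerDl [X in X *: _](_ : _ = 0) ?scale0r //.
set a := c _ _.
rewrite (_ : _ + _ = a * (s l l * r l m') * r i m' * (s i l * s l i + 1)); last by ring.
by rewrite s_anti // addNr mulr0.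
Qed.

End Anticommutator.

(** * Bases indexed by a list, and the Fischer decomposition *)

Section EnumeratedBasis.
Variables (K : fieldType) (V : lmodType K).

(** A variant of [is_basis] whose combinations always run over the whole list [S], so that no
    supports have to be tracked through the tower. *)
Definition enum_basis (I : eqType) (S : seq I) (v : I -> V) (M : V -> Prop) :=
  [/\ forall i, i \in S -> M (v i),
      forall c : I -> K, \sum_(i <- S) c i *: v i = 0 -> forall i, i \in S -> c i = 0
    & forall x, M x -> exists c : I -> K, x = \sum_(i <- S) c i *: v i].

Lemma eq_enum_basis (I : eqType) (S : seq I) (v v' : I -> V) M :
  {in S, v =1 v'} -> enum_basis S v M -> enum_basis S v' M.
Proof.
move=> e [vM vfree vspan].
have sumE (c : I -> K) : \sum_(i <- S) c i *: v' i = \sum_(i <- S) c i *: v i.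
  by apply: eq_big_seq => i iS; rewrite e.
split=> [i iS|c|x /vspan[c ->]]; first by rewrite -e //; apply: vM.
  by rewrite sumE; apply: vfree.
by exists c; rewrite sumE.
Qed.

Lemma is_basis_enum (I : eqType) (S : seq I) (P : pred I) (v : I -> V) M :
  uniq S -> (forall i, P i = (i \in S)) -> enum_basis S v M -> is_basis P v M.
Proof.
move=> uS PS [vM vfree vspan]; split=> [i|s c us sP s0 i si|x /vspan[c ->]].
- by rewrite PS; apply: vM.
- have sS : {subset s <= S} by move=> t /(allP sP); rewrite PS.
  (* Extension by zero turns a relation over [s] into one over [S]. *)
  pose c' t := if t \in s then c t else 0.
  suff /vfree/(_ i (sS _ si)) : \sum_(t <- S) c' t *: v t = 0 by rewrite /c' si.
  rewrite -[RHS]s0 (bigID (mem s)) /= [X in _ + X]big1 ?addr0.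
    rewrite -big_filter (perm_big s) /=.
      by apply: eq_big_seq => t ts; rewrite /c' ts.
    apply: uniq_perm => //; first exact: filter_uniq.
    by move=> t; rewrite mem_filter; case: (boolP (t \in s)) => // /sS ->.
  by move=> t /negPf ts; rewrite /c' ts scale0r.
- by exists S, c; split=> //; apply/allP => t; rewrite PS.
Qed.

(** Bijectivity of [f] is asked only from [P] to [M]; closure of [P] under combinations lets
    injectivity apply to a vanishing sum. *)
Lemma enum_basis_image (I : eqType) (S : seq I) (v : I -> V) (P M : V -> Prop)
    (f : {linear V -> V}) :
  P 0 -> (forall a u w, P u -> P w -> P (a *: u + w)) ->
  (forall u, P u -> M (f u)) -> (forall u, P u -> f u = 0 -> u = 0) ->
  (forall w, M w -> exists2 u, P u & w = f u) ->
  enum_basis S v P -> enum_basis S (f \o v) M.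
Proof.
move=> P0 Plin fM finj fsurj [vP vfree vspan].
have fE (c : I -> K) :
    \sum_(i <- S) c i *: (f \o v) i = f (\sum_(i <- S) c i *: v i).
  by rewrite linear_sum; apply: eq_bigr => i _; rewrite linearZ.
split=> [i /vP/fM // |c|w /fsurj[u /vspan[c ->] ->]]; last by exists c; rewrite fE.
rewrite fE => /finj h; apply: vfree; apply: h.
by rewrite big_seq; apply: big_rec => // i u iS; apply/Plin/vP.
Qed.

End EnumeratedBasis.

(** * The Fischer decomposition for an abstract pair of operators *)

Section Fischer.
Variables (K : fieldType) (V : lmodType K) (D X : {linear V -> V}).
Variables (P : nat -> V -> Prop) (h : nat -> K) (lam : nat -> nat -> K).
Hypothesis P0 : forall k, P k 0.
Hypothesis Plin : forall k a u v, P k u -> P k v -> P k (a *: u + v).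
Hypothesis PX : forall k u, P k u -> P k.+1 (X u).
Hypothesis PD : forall k u, P k u -> P k.-1 (D u).
Hypothesis D0 : forall u, P 0 u -> D u = 0.
Hypothesis anti : forall k u, P k u -> D (X u) + X (D u) = h k *: u.
Hypothesis lam0 : forall d, lam d 0 = 0.
Hypothesis lamS : forall d a, lam d a.+1 + lam d a = h (d + a).
Hypothesis lam_neq0 : forall d a, lam d a.+1 != 0.

Let M k u := P k u /\ D u = 0.

Lemma P_iterX d a u : P d u -> P (d + a) (iter a X u).
Proof. by move=> Pu; elim: a => [|a IH]; rewrite ?addn0 // addnS; apply: PX. Qed.

Lemma iterZ a (c : K) u : iter a X (c *: u) = c *: iter a X u.
Proof. by elim: a => //= a ->; rewrite linearZ. Qed.

Lemma iter0 a : iter a X 0 = 0.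
Proof. by elim: a => //= a ->; rewrite linear0. Qed.

Lemma iter_sum a (J : Type) (s : seq J) (u : J -> V) :
  iter a X (\sum_(j <- s) u j) = \sum_(j <- s) iter a X (u j).
Proof. by elim: a => //= a ->; rewrite linear_sum. Qed.

Lemma P_sum (J : eqType) (s : seq J) k (u : J -> V) :
  (forall j, j \in s -> P k (u j)) -> P k (\sum_(j <- s) u j).
Proof.
move=> Pu; rewrite big_seq; apply: big_rec => // j v js Pv.
by rewrite -[u j]scale1r; apply/Plin/Pv/Pu.
Qed.

(** Moving [D] past one [X] turns the scalar [lam d a] into [h (d + a) - lam d a], which is
    [lam d a.+1] by [lamS]. *)
Lemma lower_iterX d a u : M d u -> D (iter a.+1 X u) = lam d a.+1 *: iter a X u.
Proof.
move=> [Pu Du]; elim: a => [|a IH].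
  have := anti Pu; rewrite Du linear0 addr0 /= => ->.
  by rewrite -{1}[d]addn0 -lamS lam0 addr0.
have := anti (P_iterX a.+1 Pu); rewrite IH linearZ /= => /eqP.
rewrite -lamS scalerDl addrC; set y := lam d a.+1 *: _.
by rewrite [X in _ == X]addrC => /eqP/addrI.
Qed.

(** Induction on the degree: decompose [D p], divide its components by the scalars of [lower_iterX]
    and raise them once more. This gives [s] with [D s = D p], and [p - s] is the missing component
    in the kernel. *)
Lemma fischer_exists k p : P k p -> exists u : nat -> V,
  (forall a, (a <= k)%N -> M (k - a) (u a)) /\ p = \sum_(a < k.+1) iter a X (u a).
Proof.
elim: k p => [|k IH] p Pp.
  exists (fun=> p); split=> [a _|]; last by rewrite big_ord_recl big_ord0 addr0.
  by rewrite sub0n; split=> //; apply: D0.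
have [u [Mu Dp]] := IH _ (PD Pp).
pose w a := (lam (k - a) a.+1)^-1 *: u a.
have Mw a : (a <= k)%N -> M (k - a) (w a).
  move=> /Mu[Pu Du]; split; last by rewrite linearZ /= Du scaler0.
  by rewrite /w -[_ *: _]addr0; apply: Plin.
pose s := \sum_(a < k.+1) iter a.+1 X (w a).
have Ps : P k.+1 s.
  apply: P_sum => -[a lt_ak] _ /=; have le_ak : (a <= k)%N by [].
  by have /PX := P_iterX a (proj1 (Mw a le_ak)); rewrite subnK.
have Ds : D s = D p.
  rewrite Dp linear_sum; apply: eq_bigr => -[a lt_ak] _ /=.
  rewrite -[X (iter a X _)]/(iter a.+1 X _) (lower_iterX _ (Mw a lt_ak)).
  by rewrite iterZ scalerA divff // scale1r.
exists (fun a => if a is a'.+1 then w a' else p - s); split=> [[|a]|] //.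
- move=> _; rewrite subn0; split; last by rewrite linearB /= Ds subrr.
  by rewrite addrC -scaleN1r; apply: Plin.
- by rewrite ltnS subSS; apply: Mw.
- by rewrite big_ord_recl /= subrK.
Qed.

(** Applying [D] kills the term of index 0 and yields a relation of degree one less between nonzero
    multiples of the other components. *)
Lemma fischer_unique k (u : nat -> V) :
  (forall a, (a <= k)%N -> M (k - a) (u a)) ->
  \sum_(a < k.+1) iter a X (u a) = 0 -> forall a, (a <= k)%N -> u a = 0.
Proof.
elim: k u => [|k IH] u Mu.
  by rewrite big_ord_recl big_ord0 addr0 /= => u0 a; rewrite leqn0 => /eqP ->.
rewrite big_ord_recl /= => s0.
have Mu' a : (a <= k)%N -> M (k - a) (u a.+1) by exact: (Mu a.+1).
have uS a : (a <= k)%N -> u a.+1 = 0.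
  move=> le_ak; apply/eqP; suff/eqP: lam (k - a) a.+1 *: u a.+1 = 0.
    by rewrite scaler_eq0 (negPf (lam_neq0 _ _)).
  move: a le_ak; apply: (IH (fun b => lam (k - b) b.+1 *: u b.+1)) => [b /Mu'[Pu Du]|].
    split; last by rewrite linearZ /= Du scaler0.
    by rewrite -[_ *: _]addr0; apply: Plin.
  have := congr1 D s0; rewrite linear0 linearD /= (proj2 (Mu 0%N isT)) add0r => s1.
  rewrite -[RHS]s1 linear_sum; apply: eq_bigr => -[b lt_bk] _ /=.
  by rewrite iterZ -(lower_iterX _ (Mu' b lt_bk)).
case=> [_|a]; last exact: uS.
move: s0; rewrite big1 ?addr0 // => -[a lt_ak] _.
by rewrite /bump /= uS // iter0 linear0.
Qed.

(** The map [g] packs a basis index and an exponent of [X] into one index, and [gi] unpacks it. *)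
Lemma enum_basis_fischer (I J : eqType) (S : nat -> seq I) (v : I -> V)
    (g : I -> nat -> J) (gi : J -> I * nat) k :
  (forall i a, gi (g i a) = (i, a)) ->
  (forall d, enum_basis (S d) v (M d)) ->
  enum_basis [seq g i a | a <- iota 0 k.+1, i <- S (k - a)%N]
    (fun j => iter (gi j).2 X (v (gi j).1)) (P k).
Proof.
move=> gK bS.
have sumE (c : J -> K) :
    \sum_(j <- [seq g i a | a <- iota 0 k.+1, i <- S (k - a)%N])
       c j *: iter (gi j).2 X (v (gi j).1)
    = \sum_(a < k.+1) iter a X (\sum_(i <- S (k - a)%N) c (g i a) *: v i).
  rewrite big_allpairs_dep -[iota 0 _]/(index_iota 0 k.+1) big_mkord; apply: eq_bigr => a _.
  rewrite iter_sum.
  by apply: eq_bigr => i _; rewrite gK iterZ.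
split=> [j /allpairsPdep[a [i [a_k iS ->]]]|c|x].
- rewrite gK /=; move: a_k; rewrite mem_iota /= add0n ltnS => le_ak.
  have [vM _ _] := bS (k - a)%N.
  by have := P_iterX a (proj1 (vM i iS)); rewrite subnK.
- rewrite sumE => s0 j /allpairsPdep[a [i [a_k iS ->]]].
  have [_ vfree _] := bS (k - a)%N.
  apply: (vfree (fun i => c (g i a))) => //.
  apply: (fischer_unique (u := fun a => \sum_(i <- S (k - a)%N) c (g i a) *: v i) _ s0).
    move=> b _; have [vM _ _] := bS (k - b)%N; split.
      by apply: P_sum => t tS; rewrite -[_ *: _]addr0; apply: Plin => //; case: (vM t tS).
    rewrite linear_sum big_seq big1 // => t /vM[_ Dt].
    by rewrite linearZ /= Dt scaler0.
  by move: a_k; rewrite mem_iota.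
- move=> /fischer_exists[u [Mu ->]].
  (* The coefficients for all [a] are chosen at once; beyond [k], where [u a] is unconstrained, the
     zero function is supplied. *)
  have /choice[c cE] a : exists c : I -> K,
      (a <= k)%N -> u a = \sum_(i <- S (k - a)%N) c i *: v i.
    case: (leqP a k) => [/Mu|_]; last by exists (fun=> 0).
    by case: (bS (k - a)%N) => _ _ vspan /vspan[c ->]; exists c.
  exists (fun j => c (gi j).2 (gi j).1); rewrite sumE.
  apply: eq_bigr => -[a lt_ak] _ /=; rewrite cE //.
  by under [in RHS]eq_bigr do rewrite gK.
Qed.

End Fischer.

(** * Compositions of an integer, zero parts allowed, built by appending the last part *)

Fixpoint comps m k : seq (m.+1.-tuple nat) :=
  match m with
  | 0 => [:: [tuple k]]
  | m'.+1 => [seq rcons_tuple t a | a <- iota 0 k.+1, t <- comps m' (k - a)%N]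
  end.

(** The inverse of [rcons_tuple]. The last entry is split off because it is the exponent of the
    outermost operator in [chi]. *)
Definition tuple_unrcons m (t : m.+2.-tuple nat) : m.+1.-tuple nat * nat :=
  ([tuple tnth t (widen_ord (leqnSn m.+1) i) | i < m.+1], tnth t ord_max).

Lemma rcons_tupleK m (t : m.+1.-tuple nat) a : tuple_unrcons (rcons_tuple t a) = (t, a).
Proof.
congr (_, _); last by rewrite (tnth_nth 0%N) /= nth_rcons size_tuple ltnn eqxx.
apply: eq_from_tnth => i; rewrite tnth_mktuple !(tnth_nth 0%N) /= nth_rcons size_tuple.
by rewrite ltn_ord.
Qed.

Lemma tuple_unrconsK m (t : m.+2.-tuple nat) :
  rcons_tuple (tuple_unrcons t).1 (tuple_unrcons t).2 = t.
Proof.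
apply: eq_from_tnth => i; rewrite [LHS](tnth_nth 0%N) nth_rcons (size_tuple (tuple_unrcons t).1).
case: ltngtP => [lt_im|gt_im|e].
- rewrite -[RHS](_ : tnth (tuple_unrcons t).1 (Ordinal lt_im) = _).
    by rewrite [RHS](tnth_nth 0%N).
  by rewrite tnth_mktuple; congr tnth; apply: val_inj.
- by have := ltn_ord i; rewrite ltnS leqNgt gt_im.
- by congr tnth; apply: val_inj.
Qed.

Lemma sum_tuple_rcons m (t : m.+1.-tuple nat) a :
  (\sum_(l < m.+2) tnth (rcons_tuple t a) l = \sum_(l < m.+1) tnth t l + a)%N.
Proof.
rewrite big_ord_recr /=; congr (_ + _)%N.
  apply: eq_bigr => l _; rewrite !(tnth_nth 0%N) /= nth_rcons size_tuple.
  by rewrite ltn_ord.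
by rewrite (tnth_nth 0%N) /= nth_rcons size_tuple ltnn eqxx.
Qed.

Lemma mem_comps m k (t : m.+1.-tuple nat) :
  (t \in comps m k) = ((\sum_(l < m.+1) tnth t l)%N == k).
Proof.
elim: m k t => [|m IH] k t.
  rewrite big_ord1 inE; apply/eqP/eqP => [->|<-]; first by rewrite (tnth_nth 0%N).
  by apply: eq_from_tnth => i; rewrite ord1 [RHS](tnth_nth 0%N).
rewrite -[comps _ _]/[seq rcons_tuple t a | a <- iota 0 k.+1, t <- comps m (k - a)%N].
apply/allpairsPdep/eqP => [[a [t' [a_k /[!IH]/eqP e ->]]]|<-].
  rewrite sum_tuple_rcons e subnK //.
  by move: a_k; rewrite mem_iota.
rewrite -(tuple_unrconsK t); move: (tuple_unrcons t).1 (tuple_unrcons t).2 => t' a.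
by exists a, t'; rewrite sum_tuple_rcons mem_iota add0n ltnS leq_addl IH addnK.
Qed.

Lemma uniq_comps m k : uniq (comps m k).
Proof.
elim: m k => [//|m IH k].
rewrite -[comps _ _]/[seq rcons_tuple t a | a <- iota 0 k.+1, t <- comps m (k - a)%N].
apply: allpairs_uniq_dep => [|a _|[a t] [b u] _ _ /= e].
- exact: (iota_uniq 0 k.+1).
- exact: IH.
- have := congr1 (@tuple_unrcons m) e.
  by rewrite !rcons_tupleK => -[-> ->].
Qed.

Section Towers.
Variables (R : realType) (lq : R[i]) (n : nat) (mu : 'I_n -> R).
Hypothesis lq_neq0 : complex.Re lq != 0.
Hypothesis mu_gt0 : forall l, 0 < mu l.
Implicit Types (i l : 'I_n) (j k : nat) (m : 'X_{1..n}) (p : {mpoly R[i][n]}).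

Local Notation qpow := (qpow lq).
Local Notation qbr := (qbr lq).
Local Notation gam := (gam mu).
Local Notation gamsum := (gamsum mu).
Local Notation Dq := (Dq lq mu).
Local Notation Rq := (Rq lq mu).
Local Notation Dbr := (Dbr lq mu).
Local Notation Xbr := (Xbr lq mu).
Local Notation Phom := (@Phom R n).
Local Notation Mhom := (Mhom lq mu).
Local Notation CK := (CK lq mu).
Local Notation chi := (chi lq mu).

(** * The operators D_[j] and X_[j] *)

(** The exponent of q in the eigenvalue on x^m of the product of the q^(gamma_l) T_(q,l) over l <
    j. *)
Definition wt j m : R := \sum_(l < n | (l < j)%N) (gam l + (m l)%:R).

(* The eigenvalue of [Rq j i] on the monomial [m]: the [wt] terms give half the
   sum of gam l + m l over i < l < j minus half the sum over l < i. *)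
Definition rho j i m : R[i] :=
  qpow ((wt j m - wt i.+1 m - wt i m) / 2)
  * (-1) ^+ (\sum_(l < n | (i < l)%N) m l).

(** The two dilation terms combine into [mu_i + a]_q and the two reflection terms into (-1)^a
    [mu_i]_q, where a = [m i] + 1. *)
Lemma mcoeff_Dq i p m : (Dq i p)@_m = qbr (mu i) (m i).+1 * p@_(m + U_(i)).
Proof.
rewrite [LHS]mcoeff_Dunkl !mulrA -mulrBl; congr (_ * _).
rewrite -!qpowMn mul1r mulN1r.
rewrite /Defs.qbr /Defs.qnum.
rewrite [- (mu i + _)]opprD.
rewrite !(qpowD _ (mu i)) (qpowD _ (- mu i)).
set s := _ ^+ _.
move: (qpow (mu i)) (qpow (- mu i)) (qpow _%:R) (qpow (- _%:R)) (_^-1) => x y z t u.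
ring.
Qed.

Lemma wtS i m : wt i.+1 m = wt i m + (gam i + (m i)%:R).
Proof.
rewrite /wt (bigD1 i) //= addrC; congr (_ + _); apply: eq_bigl => l.
by rewrite ltnS (ltn_neqAle l) andbC.
Qed.

Lemma wt_split i j m : (i < j)%N ->
  wt j m = wt i.+1 m + \sum_(l < n | (i < l < j)%N) (gam l + (m l)%:R).
Proof.
move=> lt_ij; rewrite /wt (bigID (fun l : 'I_n => (l < i.+1)%N)) /=.
congr (_ + _); apply: eq_bigl => l; last by rewrite -leqNgt andbC.
by rewrite andb_idl // => /leq_trans; apply.
Qed.

Lemma mcoeff_Rq j i p m : (i < j)%N -> (Rq j i p)@_m = rho j i m * p@_m.
Proof.
move=> lt_ij; rewrite /Defs.Rq /=.
rewrite (mcoeff_comp _ (c := fun l m => qpow (- (gam l / 2)) * qpow (- 2^-1) ^+ m l)).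
rewrite (mcoeff_comp _ (c := fun l m => qpow (gam l / 2) * (qpow 2^-1 ^+ m l * (-1) ^+ m l))).
rewrite (mcoeff_comp _ (c := fun l m => (-1) ^+ m l)).
- rewrite /rho !mulrA; congr (_ * _).
  under eq_bigr do rewrite -qpowMn -qpowD.
  under [in X in _ * X * _]eq_bigr do rewrite mulrA -qpowMn -qpowD.
  rewrite big_split /= !qpow_sum mulrA -qpowD -mulrA -prodrXr; congr (qpow _ * _).
    rewrite (wt_split _ lt_ij) [wt i.+1 m + _]addrC addrK.
    rewrite mulrBl [RHS]addrC -mulNr -sumrN !mulr_suml.
    by congr (_ + _); apply: eq_bigr => l _; field.
  (* The reflections at i < l < j and those at l >= j together make up all l > i. *)
  rewrite [RHS](bigID (fun l : 'I_n => (l < j)%N)) /=; congr (_ * _).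
  by apply: eq_bigl => l; rewrite -leqNgt andb_idl // => /(leq_trans lt_ij).
- by move=> l q m'; rewrite mcoeff_msubst.
- by move=> l q m'; rewrite mcoeffZ !mcoeff_msubst !mulrA.
- by move=> l q m'; rewrite mcoeffZ mcoeff_msubst mulrA.
Qed.

Lemma mcoeff_Dbr j p m :
  (Dbr j p)@_m = \sum_(i < n | (i < j)%N)
    qbr (mu i) (m i).+1 * rho j i (m + U_(i)) * p@_(m + U_(i)).
Proof.
rewrite [LHS]raddf_sum; apply: eq_bigr => i lt_ij.
by rewrite /= mcoeff_Dq (mcoeff_Rq _ _ lt_ij) mulrA.
Qed.

Lemma Dbr_is_linear j : linear (Dbr j).
Proof. exact: (lowering_is_linear (c := fun i => qbr (mu i)) (mcoeff_Dbr j)). Qed.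

Lemma Xbr_is_linear j : linear (Xbr j).
Proof.
apply: (raising_is_linear (Q := fun i => (i < j)%N) (r := rho j) (Y := Rq j)) => //.
by move=> i p m lt_ij; apply: mcoeff_Rq.
Qed.

Lemma Xbr_mpolyX j m :
  Xbr j 'X_[m] = \sum_(i < n | (i < j)%N) rho j i m *: 'X_[m + U_(i)].
Proof.
apply: (raising_mpolyX (Q := fun i => (i < j)%N) (r := rho j) (Y := Rq j)) => //.
by move=> i p m' lt_ij; apply: mcoeff_Rq.
Qed.

Lemma Dbr_mpolyX j m :
  Dbr j 'X_[m]
  = \sum_(i < n | (i < j)%N) (qbr (mu i) (m i) * rho j i m) *: 'X_[m - U_(i)].
Proof.
by apply: (lowering_mpolyX (c := fun i => qbr (mu i)) _ (mcoeff_Dbr j)) => i; rewrite qbr0.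
Qed.

Lemma wtDU j m i : wt j (m + U_(i)) = wt j m + (i < j)%N%:R.
Proof.
rewrite /wt; under eq_bigr do rewrite mnmDE natrD addrA mnm1E.
rewrite big_split; congr (_ + _) => /=.
case: ltnP => [lt_ij|le_ji].
  rewrite (bigD1 i) //= eqxx big1 ?addr0 // => l /andP[_ /negPf].
  by rewrite eq_sym => ->.
by rewrite big1 // => l lt_lj; case: eqP => // e; move: lt_lj; rewrite -e ltnNge le_ji.
Qed.

(** This is why the anticommutator is a scalar on P_k(R^j): there the weight depends on the degree
    alone. *)
Lemma wt_homog j m : (forall l, (j <= l)%N -> m l = 0%N) ->
  wt j m = gamsum j + (mdeg m)%:R.
Proof.
move=> m0; rewrite /wt big_split /=; congr (_ + _).
rewrite mdegE -natr_sum; congr (_%:R).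
rewrite [RHS](bigID (fun l : 'I_n => (l < j)%N)) /= [X in _ = (_ + X)%N]big1 ?addn0 //.
by move=> l; rewrite -leqNgt => /m0.
Qed.

(** Plays the part of [s] in the anticommutator computation; unlike [rho], it does not depend on the
    monomial. *)
Definition rhoshift j l i : R[i] :=
  qpow (((i < j)%N%:R - (i < l.+1)%N%:R - (i < l)%N%:R) / 2) * (-1) ^+ (l < i)%N.

Lemma rhoDU j l m i : rho j l (m + U_(i)) = rhoshift j l i * rho j l m.
Proof.
rewrite /rho /rhoshift !wtDU mulrACA -qpowD -exprD.
congr (qpow _ * _ ^+ _); first by field.
under eq_bigr do rewrite mnmDE mnm1E addnC.
rewrite big_split /=; congr (_ + _)%N.
case: ltnP => [lt_li|le_il].
  rewrite (bigD1 i) //= eqxx big1 ?addn0 // => l' /andP[_ /negPf].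
  by rewrite eq_sym => ->.
by rewrite big1 // => l' lt_ll'; case: eqP => // e; move: lt_ll'; rewrite -e ltnNge le_il.
Qed.

Lemma rhoshift_diag j i : (i < j)%N -> rhoshift j i i = 1.
Proof.
by move=> lt_ij; rewrite /rhoshift lt_ij ltnn ltnSn subr0 subrr mul0r qpow0 mul1r.
Qed.

(** The two factors carry q^(1/2) and q^(-1/2), and exactly one of them carries a sign. *)
Lemma rhoshift_anti j l i : (l < j)%N -> (i < j)%N -> l != i ->
  rhoshift j i l * rhoshift j l i = -1.
Proof.
move=> lt_lj lt_ij ne_li; rewrite /rhoshift mulrACA -qpowD -exprD lt_lj lt_ij !ltnS.
have : val l != val i by [].
case: (ltngtP l i) => // _ _ /=.
  rewrite [X in qpow X](_ : _ = 0) ?qpow0 ?mul1r ?expr1 //.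
  rewrite !subr0 !subrr ?sub0r. by field.
rewrite [X in qpow X](_ : _ = 0) ?qpow0 ?mul1r ?expr1 //.
rewrite !subr0 !subrr ?sub0r. by field.
Qed.

Lemma rho_sqr j i m : rho j i m * rho j i m = qpow (wt j m - wt i.+1 m - wt i m).
Proof.
rewrite /rho mulrACA -qpowD -expr2 sqrr_sign mulr1; congr qpow.
by field.
Qed.

(** Telescoping: since gamma_i + m_i is the increment of [wt] at i, each term is a constant times
    F(i) - F(i+1) with F(a) = q^(wt j - 2 wt a), and F runs from q^(wt j) to q^(-wt j). *)
Lemma rho_diag_sum j m : (j <= n)%N ->
  \sum_(i < n | (i < j)%N)
     rho j i m * rho j i m * hnum lq (gam i + (m i)%:R) = hnum lq (wt j m).
Proof.
move=> le_jn; pose F a := qpow (wt j m - wt a m - wt a m).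
pose c : R[i] := (qpow 2^-1 + qpow (- 2^-1)) / (qpow 1 - qpow (-1)).
have wt0 : wt 0 m = 0 by rewrite /wt big_pred0.
transitivity (\sum_(i < n | (i < j)%N) c * (F i - F i.+1)).
  apply: eq_bigr => i _; rewrite rho_sqr /hnum -/c mulrCA; congr (c * _).
  by rewrite mulrBr -!qpowD /F wtS; congr (qpow _ - qpow _); ring.
rewrite -(big_ord_widen _ (fun a => c * (F a - F a.+1)) le_jn) /=.
rewrite -mulr_sumr /hnum; congr (_ * _).
under eq_bigr do rewrite -opprB.
rewrite sumrN -(big_mkord xpredT (fun a => F a.+1 - F a)) telescope_sumr //.
by rewrite opprB /F wt0 !subr0 subrr add0r.
Qed.

HB.instance Definition _ j :=
  GRing.isLinear.Build R[i] _ _ _ (Dbr j) (Dbr_is_linear j).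
HB.instance Definition _ j :=
  GRing.isLinear.Build R[i] _ _ _ (Xbr j) (Xbr_is_linear j).

(** * Homogeneous polynomials in the first variables, and the anticommutation relation on them *)

Definition mhom j k m := mdeg m = k /\ forall l, (j <= l)%N -> m l = 0%N.

Lemma PhomP j k p : Phom j k p <-> forall m, p@_m != 0 -> mhom j k m.
Proof.
split=> [[/dhomogP h1 h2] m|h].
  by rewrite -mcoeff_msupp => pm; split; [exact: h1 | exact: h2].
by split=> [|m]; [apply/dhomogP => m|]; rewrite mcoeff_msupp => /h[].
Qed.

Lemma Phom0 j k : Phom j k 0.
Proof. by apply/PhomP => m; rewrite mcoeff0 eqxx. Qed.

Lemma PhomD j k u v : Phom j k u -> Phom j k v -> Phom j k (u + v).
Proof.
move=> /PhomP hu /PhomP hv; apply/PhomP => m; rewrite mcoeffD.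
by case: (eqVneq u@_m 0) => [->|/hu //]; rewrite add0r => /hv.
Qed.

Lemma PhomZ j k (a : R[i]) u : Phom j k u -> Phom j k (a *: u).
Proof.
move=> /PhomP hu; apply/PhomP => m; rewrite mcoeffZ mulf_eq0 negb_or.
by case/andP=> _ /hu.
Qed.

Lemma Phom_sum (I : eqType) (s : seq I) (Q : pred I) j k (u : I -> {mpoly R[i][n]}) :
  (forall t, t \in s -> Q t -> Phom j k (u t)) -> Phom j k (\sum_(t <- s | Q t) u t).
Proof.
move=> h; rewrite big_seq_cond; apply: big_ind => [||t /andP[]]; last exact: h.
  exact: Phom0.
exact: PhomD.
Qed.

Lemma PhomX j k m : mhom j k m -> Phom j k 'X_[m].
Proof.
by move=> hm; apply/PhomP => m'; rewrite mcoeffX; case: (m =P m') => [<-|]; rewrite ?eqxx.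
Qed.

Lemma Phom_ind j k (Q : {mpoly R[i][n]} -> Prop) :
  Q 0 -> (forall a u v, Q u -> Q v -> Q (a *: u + v)) ->
  (forall m, mhom j k m -> Q 'X_[m]) -> forall p, Phom j k p -> Q p.
Proof.
move=> Q0 Qlin QX p /PhomP hp; rewrite [p]mpolyE big_seq.
apply: (big_rec Q) => // m u; rewrite mcoeff_msupp => /hp/QX hm hu.
exact: Qlin.
Qed.

Lemma mhomDU j k m i : (i < j)%N -> mhom j k m -> mhom j k.+1 (m + U_(i)).
Proof.
move=> lt_ij [dm m0]; split=> [|l le_jl]; first by rewrite mdegD mdeg1 addn1 dm.
rewrite mnmDE mnm1E m0 //; case: eqP => // e.
by move: lt_ij; rewrite e ltnNge le_jl.
Qed.

Lemma mhomBU j k m i : (0 < m i)%N -> mhom j k m -> mhom j k.-1 (m - U_(i)).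
Proof.
move=> mi [dm m0]; have le1 : (U_(i) <= m)%MM by rewrite lep1mP -lt0n.
split=> [|l /m0 ml]; last by rewrite mnmBE ml.
by rewrite -dm -{2}(submK le1) mdegD mdeg1 addn1.
Qed.

Lemma Phom_Xbr j k p : Phom j k p -> Phom j k.+1 (Xbr j p).
Proof.
move: p; apply: Phom_ind => [|a u v hu hv|m hm]; first by rewrite linear0; exact: Phom0.
  by rewrite Xbr_is_linear; apply/PhomD => //; apply: PhomZ.
rewrite Xbr_mpolyX; apply: Phom_sum => i _ lt_ij.
exact/PhomZ/PhomX/mhomDU.
Qed.

Lemma Phom_Dbr j k p : Phom j k p -> Phom j k.-1 (Dbr j p).
Proof.
move: p; apply: Phom_ind => [|a u v hu hv|m hm]; first by rewrite linear0; exact: Phom0.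
  by rewrite Dbr_is_linear; apply/PhomD => //; apply: PhomZ.
rewrite Dbr_mpolyX; apply: Phom_sum => i _ lt_ij.
case: (posnP (m i)) => [->|mi]; first by rewrite qbr0 mul0r scale0r; exact: Phom0.
exact/PhomZ/PhomX/mhomBU.
Qed.

Lemma Dbr_Phom0 j p : Phom j 0 p -> Dbr j p = 0.
Proof.
move: p; apply: Phom_ind => [|a u v hu hv|m [dm _]]; first by rewrite linear0.
  by rewrite Dbr_is_linear /= hu hv scaler0 addr0.
have -> : m = 0%MM by apply/eqP; rewrite -mdeg_eq0 dm.
rewrite Dbr_mpolyX big1 // => i _.
by rewrite mnm0E qbr0 mul0r scale0r.
Qed.

(** On a monomial, [qbrSD] turns the diagonal terms into values of [hnum], [rho_diag_sum] adds them
    up, and [wt_homog] replaces the weight by the degree. *)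
Lemma anticommutator j k p : (j <= n)%N -> Phom j k p ->
  Dbr j (Xbr j p) + Xbr j (Dbr j p) = hnum lq (gamsum j + k%:R) *: p.
Proof.
move=> le_jn; move: p; apply: Phom_ind => [|a u v hu hv|m [<- m0]].
- by rewrite !linear0 addr0.
- rewrite Xbr_is_linear !Dbr_is_linear Xbr_is_linear.
  rewrite scalerDr scalerA mulrC -scalerA -hu -hv scalerDr !addrA.
  by rewrite -!addrA; congr (_ + _); rewrite addrCA.
- rewrite (anticommutator_mpolyX (c := fun i => qbr (mu i)) _ (Dbr_mpolyX j)
    (Xbr_mpolyX j) (@rhoDU j)); first last.
  + by move=> *; apply: rhoshift_anti.
  + by move=> i; apply: rhoshift_diag.
  + by move=> i; rewrite qbr0.
  congr (_ *: _); rewrite -wt_homog // -rho_diag_sum //; apply: eq_bigr => i _.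
  by rewrite qbrSD.
Qed.

(** * The CK extension *)

Lemma rhoDUn j i l m a :
  rho j i (m + U_(l) *+ a) = rhoshift j i l ^+ a * rho j i m.
Proof.
elim: a => [|a IH]; first by rewrite mulm0n addm0 mul1r.
by rewrite mulmS [(U_(l) + _)%MM]addmC addmA rhoDU IH exprS mulrA.
Qed.

Lemma rho_succ i l m : (i < l)%N ->
  rho l.+1 i m = qpow ((gam l + (m l)%:R) / 2) * rho l i m.
Proof.
by move=> lt_il; rewrite /rho wtS mulrA -qpowD; congr (qpow _ * _); field.
Qed.

Lemma rho_neq0 j i m : rho j i m != 0.
Proof. by rewrite mulf_neq0 ?qpow_neq0 ?signr_eq0. Qed.

Lemma rho_last l m : (forall l', (l < l')%N -> m l' = 0%N) ->
  rho l.+1 l m = qpow (- (wt l m / 2)).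
Proof.
by move=> m0; rewrite /rho big1 // mulr1 subrr sub0r mulNr.
Qed.

Lemma gamsumS l : gamsum l.+1 = gamsum l + gam l.
Proof.
rewrite /Defs.gamsum (bigD1 l) //= addrC; congr (_ + _); apply: eq_bigl => l'.
by rewrite ltnS (ltn_neqAle l') andbC.
Qed.

Lemma mpolyXM_exp l a m : 'X_l ^+ a * 'X_[m] = 'X_[m + U_(l) *+ a] :> {mpoly R[i][n]}.
Proof. by rewrite mpolyXn -mpolyXD addmC. Qed.

(** For i < l, the reflection r_l in the twist gives (-1)^a, and passing from R_[l],i to R_[l+1],i
    gives the power of q; the summand i = l lowers the power of x_l. *)
Lemma Dbr_succ_mpolyX l m a : (forall l', (l <= l')%N -> m l' = 0%N) ->
  Dbr l.+1 ('X_l ^+ a * 'X_[m])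
  = ((-1) ^+ a * qpow ((gam l + a%:R) / 2)) *: ('X_l ^+ a * Dbr l 'X_[m])
    + (qpow (- (wt l m / 2)) * qbr (mu l) a) *: ('X_l ^+ a.-1 * 'X_[m]).
Proof.
move=> m0; rewrite mpolyXM_exp !Dbr_mpolyX (bigD1 l) //= addrC; congr (_ + _).
  rewrite mulr_sumr scaler_sumr; apply: eq_big => [i|i].
    by rewrite ltnS (ltn_neqAle i) andbC.
  rewrite ltnS -(rwP andP) => -[le_il ne_il].
  have lt_il : (i < l)%N by rewrite ltn_neqAle ne_il.
  rewrite mnmDE mulmnE mnm1E eq_sym (negPf ne_il) mul0n addn0.
  case: (posnP (m i)) => [->|mi].
    by rewrite qbr0 !mul0r !scale0r mulr0 scaler0.
  have le1 : (U_(i) <= m)%MM by rewrite lep1mP -lt0n.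
  rewrite rho_succ // mnmDE mulmnE mnm1E eqxx mul1n (m0 l) // add0n.
  rewrite rhoDUn /rhoshift ltnn [(l < i.+1)%N]ltnNge lt_il.
  rewrite [(l < i)%N]ltnNge (ltnW lt_il) /= !subr0 mul0r qpow0 mul1r expr1.
  rewrite -scalerAr scalerA mpolyXM_exp; congr (_ *: 'X_[_]); first by ring.
  by rewrite [(m - _ + _)%MM]addmC addmBA // addmC.
rewrite mnmDE mulmnE mnm1E eqxx mul1n (m0 l) // add0n.
rewrite rhoDUn rhoshift_diag // expr1n mul1r rho_last; last first.
  by move=> l' /ltnW/m0.
(* For [a] = 0 the truncated exponent [a.-1] is harmless, as its coefficient is zero. *)
rewrite mulrC; case: a => [|a]; first by rewrite qbr0 mulr0 !scale0r.
by rewrite mpolyXM_exp mulmS [(U_(l) + _)%MM]addmC addmA addmK.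
Qed.

Definition CKcoef l k a : R[i] :=
  (-1) ^+ (a * a.+1)./2 * qpow (a%:R / 2 * (gamsum l.+1 + k%:R - 1))
    / \prod_(1 <= m < a.+1) qbr (mu l) m.

Lemma CKcoef0 l k : CKcoef l k 0 = 1.
Proof. by rewrite /CKcoef big_geq // !mul0r qpow0 mulr1 divr1. Qed.

Lemma CKE l k p :
  CK l k p = \sum_(a < k.+1) CKcoef l k a *: ('X_l ^+ a * iter a (Dbr l) p).
Proof. by []. Qed.

(** The recursion that makes the two contributions to x_l^a D^(a+1) p cancel in D_[l+1] applied to
    the CK sum. *)
Lemma CKcoefS l k a : (a < k)%N ->
  CKcoef l k a.+1 * (qpow (- ((gamsum l + (k - a.+1)%:R) / 2)) * qbr (mu l) a.+1)
  = - (CKcoef l k a * ((-1) ^+ a * qpow ((gam l + a%:R) / 2))).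
Proof.
move=> lt_ak; rewrite /CKcoef big_nat_recr //.
have b0 : qbr (mu l) a.+1 != 0 by exact: qbr_neq0.
have -> : (a.+1 * a.+2)./2 = ((a * a.+1)./2 + a.+1)%N.
  have -> : (a.+1 * a.+2 = a * a.+1 + a.+1.*2)%N by rewrite -muln2; ring.
  by rewrite halfD odd_double andbF add0n doubleK.
rewrite exprD exprS invfM gamsumS natrB //.
move: (\prod_(1 <= m < a.+1) qbr (mu l) m)^-1 => P; move: ((-1) ^+ (a * a.+1)./2) => s.
(* The increment (gamma_[l+1] + k - 1)/2 of the exponent splits into the two half weights occurring
   in the recursion. *)
have -> : qpow (a.+1%:R / 2 * (gamsum l + gam l + k%:R - 1))
    = qpow (a%:R / 2 * (gamsum l + gam l + k%:R - 1)) * qpow ((gam l + a%:R) / 2)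
      * qpow ((gamsum l + (k%:R - a.+1%:R)) / 2).
  by rewrite -!qpowD -natr1; congr (qpow _); field.
rewrite qpowN; set x := qpow ((_ + (_ - _)) / 2).
have x0 : x != 0 by exact: qpow_neq0.
rewrite -[RHS]mulr1 -[X in _ = _ * X](divff b0).
by rewrite -[RHS]mulr1 -[X in _ = _ * X](divff x0); ring.
Qed.

Lemma Dbr_succ_Phom l d a p : Phom l d p ->
  Dbr l.+1 ('X_l ^+ a * p)
  = ((-1) ^+ a * qpow ((gam l + a%:R) / 2)) *: ('X_l ^+ a * Dbr l p)
    + (qpow (- ((gamsum l + d%:R) / 2)) * qbr (mu l) a) *: ('X_l ^+ a.-1 * p).
Proof.
move: p; apply: Phom_ind => [|b u v hu hv|m [dm m0]].
- by rewrite !(mulr0, linear0, scaler0) addr0.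
- rewrite [X in Dbr l.+1 X]mulrDr -scalerAr !Dbr_is_linear hu hv.
  move: (_ * qpow _) (_ * qbr _ _) => A B.
  by rewrite !mulrDr -!scalerAr !scalerDr !scalerA ![_ * b]mulrC addrACA.
- by rewrite Dbr_succ_mpolyX // wt_homog // dm.
Qed.

Lemma CK_is_linear l k : linear (CK l k).
Proof.
have iterDP a (b : R[i]) u v :
    iter a (Dbr l) (b *: u + v) = b *: iter a (Dbr l) u + iter a (Dbr l) v.
  by elim: a => //= a ->; rewrite Dbr_is_linear.
move=> b u v; rewrite !CKE scaler_sumr -big_split; apply: eq_bigr => a _ /=.
by rewrite iterDP mulrDr -scalerAr scalerDr !scalerA mulrC.
Qed.

Lemma Phom_widen l d p : Phom l d p -> Phom l.+1 d p.
Proof.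
move=> /PhomP hp; apply/PhomP => m /hp[dm m0]; split=> // l' /ltnW; exact: m0.
Qed.

Lemma Phom_mulX l j d p : (l < j)%N -> Phom j d p -> Phom j d.+1 ('X_l * p).
Proof.
move=> lt_lj; move: p; apply: Phom_ind => [|b u v hu hv|m hm].
- by rewrite mulr0; apply: Phom0.
- by rewrite mulrDr -scalerAr; apply/PhomD => //; apply: PhomZ.
- by rewrite -mpolyXD addmC; apply/PhomX/mhomDU.
Qed.

Lemma Phom_iterD l k a p : Phom l k p -> Phom l (k - a) (iter a (Dbr l) p).
Proof.
by move=> hp; elim: a => [|a IH]; rewrite ?subn0 // subnS; apply: Phom_Dbr.
Qed.

(** By [CKcoefS] the image of the term of index a is G(a) - G(a+1). The sum telescopes to zero: G(0)
    has the factor [mu, 0; q] = 0 and G(k+1) contains D^(k+1) p = 0. *)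
Lemma Mhom_CK l k p : Phom l k p -> Mhom l.+1 k (CK l k p).
Proof.
move=> hp; split.
  rewrite CKE; apply: Phom_sum => -[a lt_ak] _ _ /=; apply: PhomZ.
  have le_ak : (a <= k)%N by [].
  rewrite -[k](subnKC le_ak).
  have := Phom_widen (Phom_iterD a hp); rewrite -{1 2}[k](subnKC le_ak) addKn.
  move: (iter a _ _) (k - a)%N => u d hu {le_ak lt_ak}.
  elim: a => [|a IH]; first by rewrite mul1r.
  by rewrite addSn exprS -mulrA; apply: Phom_mulX.
rewrite CKE linear_sum /=.
pose G a := (CKcoef l k a * (qpow (- ((gamsum l + (k - a)%:R) / 2)) * qbr (mu l) a))
  *: ('X_l ^+ a.-1 * iter a (Dbr l) p).
have G0 : G 0%N = 0 by rewrite /G qbr0 !mulr0 scale0r.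
have GS : G k.+1 = 0.
  rewrite /G /= Dbr_Phom0 ?mulr0 ?scaler0 //.
  by have := Phom_iterD k hp; rewrite subnn.
have -> : \sum_(a < k.+1) Dbr l.+1 (CKcoef l k a *: ('X_l ^+ a * iter a (Dbr l) p))
    = \sum_(a < k.+1) - (G a.+1 - G a).
  apply: eq_bigr => -[a lt_ak] _ /=.
  rewrite -[_ *: _]addr0 Dbr_is_linear linear0 addr0.
  rewrite (Dbr_succ_Phom _ (Phom_iterD a hp)) scalerDr !scalerA opprB addrC.
  congr (_ + _); rewrite /G /=.
  move: lt_ak; rewrite ltnS leq_eqVlt => /orP[/eqP -> |lt_ak].
    rewrite Dbr_Phom0 ?mulr0 ?scaler0 ?oppr0 //.
    by have := Phom_iterD k hp; rewrite subnn.
  by rewrite CKcoefS // scaleNr opprK.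
rewrite sumrN -(big_mkord xpredT (fun a => G a.+1 - G a)) telescope_sumr //.
by rewrite G0 GS subrr oppr0.
Qed.

(** Only the term a = 0 survives at x_l = 0, and [p] is free of x_l. *)
Lemma msubst0_CK l k p : Phom l k p -> msubst l 0 (CK l k p) = p.
Proof.
move=> /PhomP hp; apply/mpolyP => m; rewrite mcoeff_msubst.
case: (posnP (m l)) => [ml0|ml].
  rewrite ml0 mul1r CKE big_ord_recl mcoeffD raddf_sum big1 ?addr0 => /=.
    by rewrite CKcoef0 scale1r mul1r.
  by move=> a _; rewrite mcoeffZ exprS -mulrA mcoeffXM0 ?mulr0.
rewrite expr0n eqn0Ngt ml mul0r; apply/esym/eqP; apply: contraTT ml.
by move=> /hp[_ ->].
Qed.

Lemma Phom_msubst0 l k p : Phom l.+1 k p -> Phom l k (msubst l 0 p).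
Proof.
move=> /PhomP hp; apply/PhomP => m; rewrite mcoeff_msubst expr0n.
case: (eqVneq (m l) 0%N) => [ml0|]; last by rewrite mul0r eqxx.
rewrite mul1r => /hp[dm m0]; split=> // l'; rewrite leq_eqVlt => /orP[/eqP/val_inj <- //|].
exact: m0.
Qed.

(* The vanishing of [D_[l+1] p] at [m] expresses the coefficient of [p] at
   [m + U_(l)] through coefficients of the same degree in [x_l] as [m]. *)
Lemma Dbr_eq0_inj l p : Dbr l.+1 p = 0 -> msubst l 0 p = 0 -> p = 0.
Proof.
move=> Dp p0; apply/mpolyP => m; rewrite mcoeff0.
move: {2}(m l) (erefl (m l)) => a; elim: a m => [|a IH] m ma.
  by have := congr1 (mcoeff m) p0; rewrite mcoeff_msubst ma mul1r mcoeff0.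
have le1 : (U_(l) <= m)%MM by rewrite lep1mP ma.
have := congr1 (mcoeff (m - U_(l))) Dp; rewrite mcoeff0 mcoeff_Dbr.
rewrite (bigD1 l) //= big1 ?addr0 => [|i /andP[_ ne_il]].
  rewrite submK // => /eqP; rewrite 2!mulf_eq0 (negPf (qbr_neq0 _ _ _)) //=.
  by rewrite (negPf (rho_neq0 _ _ _)) => /eqP.
rewrite (IH (_ + _)%MM) ?mulr0 // mnmDE mnmBE !mnm1E eqxx ma (negPf ne_il).
by rewrite addn0 subn1.
Qed.

(** The preimage is the restriction of [w] to x_l = 0: its extension and [w] have the same
    restriction and both lie in the kernel, so [Dbr_eq0_inj] identifies them. *)
Lemma CK_surj l k w : Mhom l.+1 k w -> exists2 p, Phom l k p & w = CK l k p.
Proof.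
move=> [hw Dw]; have hp := Phom_msubst0 hw.
exists (msubst l 0 w) => //; apply/eqP; rewrite -subr_eq0; apply/eqP.
have [_ DCK] := Mhom_CK hp.
apply: (@Dbr_eq0_inj l).
  by rewrite linearB /= Dw DCK subrr.
apply/mpolyP => m; rewrite mcoeff_msubst mcoeffB mulrBr -!mcoeff_msubst.
by rewrite msubst0_CK // subrr mcoeff0.
Qed.

HB.instance Definition _ l k :=
  GRing.isLinear.Build R[i] _ _ _ (CK l k) (CK_is_linear l k).

(** * The tower of bases *)

(** Ensures gamma_[j] + d - 1/2 > 0, the positivity that [qbr_neq0] requires of the Fischer
    scalars. *)
Lemma gamsum_gt_half j : (0 < n)%N -> (0 < j)%N -> 2^-1 < gamsum j.
Proof.
move=> n_gt0 j_gt0; rewrite /Defs.gamsum (bigD1 (Ordinal n_gt0)) //= /gam.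
rewrite -addrA addrC -[X in X < _]addr0 -addrA ltrD2l.
rewrite addrC ltr_wpDr //; apply: sumr_ge0 => l _.
by rewrite addr_ge0 ?ltW // invr_gt0 ltr0n.
Qed.

Lemma eq_chi (s s' : seq nat) (m : nat) (lt_mn : (m < n)%N) :
  (forall l : nat, (l <= m)%N -> nth 0%N s l = nth 0%N s' l) ->
  chi s lt_mn = chi s' lt_mn.
Proof.
elim: m lt_mn => [|m IH] lt_mn e /=; first by rewrite e.
rewrite e // (IH _ (fun (l : nat) le => e l (leqW le))); congr (iter _ _ (CK _ _ _)).
by apply: eq_bigr => l _; apply: e; apply: ltnW.
Qed.

Lemma enum_basis_CK (I : eqType) (S : seq I) (v : I -> {mpoly R[i][n]}) (l : 'I_n) k :
  enum_basis S v (Phom l k) -> enum_basis S (CK l k \o v) (Mhom l.+1 k).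
Proof.
apply: enum_basis_image.
- exact: Phom0.
- by move=> a u w hu hw; apply: PhomD => //; apply: PhomZ.
- by move=> u; apply: Mhom_CK.
- move=> u hu e; rewrite -(msubst0_CK hu) e; apply/mpolyP => m.
  by rewrite mcoeff_msubst mcoeff0 mulr0.
- by move=> w; apply: CK_surj.
Qed.

(** The induction on [m] is for all degrees at once, since the Fischer decomposition in degree k
    involves the kernels in every degree up to k. *)
Lemma enum_basis_chi (m : nat) (lt_mn : (m < n)%N) k :
  enum_basis (comps m k) (fun t => chi t lt_mn) (Phom m.+1 k).
Proof.
elim: m lt_mn k => [|m IH] lt_mn k.
  have XE a : 'X_(Ordinal lt_mn) ^+ a = 'X_[U_(Ordinal lt_mn) *+ a] :> {mpoly R[i][n]}.
    by rewrite mpolyXn.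
  have mcoeffXU1 m : ('X_[m] : {mpoly R[i][n]})@_m = 1 by rewrite mcoeffX eqxx.
  split=> [t|c|p /PhomP hp] /=.
  - rewrite inE => /eqP ->; rewrite XE; apply: PhomX; split.
      by rewrite mdegMn mdeg1 mul1n.
    move=> l l_gt0; rewrite mulmnE mnm1E; case: eqP => // e.
    by move: l_gt0; rewrite -e.
  - rewrite big_seq1 /= XE => /(congr1 (mcoeff (U_(Ordinal lt_mn) *+ k))).
    rewrite mcoeffZ mcoeffXU1 mulr1 mcoeff0 => c0 t.
    by rewrite inE => /eqP ->.
  - exists (fun=> p@_(U_(Ordinal lt_mn) *+ k)); rewrite big_seq1 /= XE.
    apply/mpolyP => m; rewrite mcoeffZ mcoeffX.
    case: (_ =P m) => [->|ne]; first by rewrite mulr1.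
    rewrite mulr0; apply/eqP/negP => /negP/hp[dm m0]; apply: ne.
    (* A monomial of degree k in x_1 alone can only be x_1^k. *)
    apply/mnmP => l; rewrite mulmnE mnm1E.
    case: (eqVneq (Ordinal lt_mn) l) => [<-|ne_l]; last first.
      by rewrite m0 // lt0n; apply: contraNneq ne_l => l0; apply/eqP/val_inj.
    rewrite mul1n -dm mdegE (bigD1 (Ordinal lt_mn)) //= big1 ?addn0 // => l' ne_l'.
    by rewrite m0 // lt0n; apply: contraNneq ne_l' => l0; apply/eqP/val_inj.
have M_basis d : enum_basis (comps m d)
    (fun t => CK (Ordinal lt_mn) (\sum_(l < m.+1) nth 0%N t l)%N (chi t (ltnW lt_mn)))
    (Mhom m.+2 d).
  have := enum_basis_CK (l := Ordinal lt_mn) (IH (ltnW lt_mn) d).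
  apply: eq_enum_basis => t; rewrite mem_comps => /eqP <- /=.
  by congr (CK _ _ _); apply: eq_bigr => l _; rewrite (tnth_nth 0%N).
have n_gt0 : (0 < n)%N by exact: leq_ltn_trans (leq0n _) lt_mn.
(* The scalars are [gamma_[j] + d - 1/2, a; q]: the shift by 1/2 compensates the one in [qbrSD]. *)
have F_basis := @enum_basis_fischer R[i] {mpoly R[i][n]} (Dbr m.+2) (Xbr m.+2)
  (Phom m.+2) (fun d => hnum lq (gamsum m.+2 + d%:R))
  (fun d => qbr (gamsum m.+2 + d%:R - 2^-1)) (@Phom0 m.+2) _
  (@Phom_Xbr m.+2) (@Phom_Dbr m.+2) (@Dbr_Phom0 m.+2).
have : enum_basis (comps m.+1 k) (fun t => iter (tuple_unrcons t).2 (Xbr m.+2)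
    (CK (Ordinal lt_mn) (\sum_(l < m.+1) nth 0%N (tuple_unrcons t).1 l)%N
      (chi (tuple_unrcons t).1 (ltnW lt_mn)))) (Phom m.+2 k).
  apply: F_basis (@rcons_tupleK m) M_basis.
  - by move=> d a u w hu hw; apply: PhomD => //; apply: PhomZ.
  - by move=> d u; apply: anticommutator.
  - by move=> d; rewrite qbr0.
  - by move=> d a; rewrite qbrSD natrD; congr (hnum _ _); ring.
  - move=> d a; apply: qbr_neq0 => //; rewrite addrAC ltr_wpDr // subr_gt0.
    exact: gamsum_gt_half.
(* The stage before the last raising reads only the first m + 1 entries of the index, so the
   appended entry does not affect it. *)
apply: eq_enum_basis => t _; rewrite -[in RHS](tuple_unrconsK t).
move: (tuple_unrcons t) => [t' a] /=.
rewrite nth_rcons size_tuple ltnn eqxx; congr (iter _ _ _).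
have nth_t (l : nat) : (l <= m)%N -> nth 0%N t' l = nth 0%N (rcons t' a) l.
  by move=> le_lm; rewrite nth_rcons size_tuple ltnS le_lm.
rewrite (eq_chi _ nth_t); congr (CK _ _ _).
by apply: eq_bigr => l _; apply: nth_t; rewrite -ltnS.
Qed.

End Towers.

Theorem mainTheorem7 (R : realType) (q lq : R[i])
    (q_neq0 : q != 0) (normq_neq1 : `|q| != 1) (exp_lq : cexp lq = q)
    (n : nat) (n_ge3 : (3 <= n)%N)
    (mu : 'I_n -> R) (mu_gt0 : forall l : 'I_n, 0 < mu l)
    (k : nat) :
  is_basis
    (fun js : n.-1.-tuple nat => (\sum_(l < n.-1) tnth js l)%N == k)
    (psi lq mu n_ge3)
    (Mhom lq mu n k).
Proof.
have lq_neq0 : complex.Re lq != 0.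
  by apply: contraNneq normq_neq1 => Re0; rewrite -exp_lq norm_cexp Re0 expR0.
(* With n = m + 2 the predecessors in the type of the index compute, and what remains is one CK
   extension, at x_n, of the basis of P_k(R^(n-1)). *)
case: n n_ge3 mu mu_gt0 => [//|[//|m]] n_ge3 mu mu_gt0 /=.
apply: (is_basis_enum (uniq_comps m k)); first by move=> t; rewrite mem_comps.
have := enum_basis_CK lq_neq0 mu_gt0 (l := Ordinal (ltn_pred1n n_ge3))
  (enum_basis_chi lq_neq0 mu_gt0 (ltn_pred2n n_ge3) k).
by apply: eq_enum_basis => t; rewrite mem_comps => /eqP <-.
Qed.
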